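(* Let $P_m(A)=\sum_{i=0}^m b_iA^i$ be a matrix polynomial of degree $m\ge 8$. For $s\ge 2$ and $m=4s+p$ with $p\ge 0$ ($s,p$ integers), $P_m(A)$ can be evaluated using the scheme $z_{1ps}(A)$ defined in the context, with a cost of $$C_{z_{1ps}}(m)=s+1+\lceil p/s\rceil$$ matrix products. Furthermore, for any $m\ge 8$ (excluding $m=9,11$), there exists a value of $s$ (with $s\ge 2$, $4s\le m$ and $p=m-4s$) such that $$C_{z_{1ps}}(m)=C_{PS}(m)-1,$$ where $C_{PS}(m)$ is the cost of the optimal Paterson--Stockmeyer method.
   Context: Cost model: the cost of evaluating a polynomial at a square matrix $A$ is the number of matrix--matrix multiplications used; linear combinations of matrices are not counted, and matrix powers are computed once, stored and reused. Paterson--Stockmeyer cost: the minimum cost of the Paterson--Stockmeyer method for degree $m$ is $$C_{PS}(m)=\min_{\sigma}\left(\sigma+\left\lceil \frac{m}{\sigma}\right\rceil-2\right),$$ the minimum being over integers $\sigma\ge 1$; the optimal value of $\sigma$ is either $\lfloor\sqrt m\rfloor$ or $\lceil\sqrt m\rceil$. The scheme $z_{1ps}$: let $s\ge 2$, $p\ge 0$, $m=4s+p$, $t=\lfloor p/s\rfloor$ and $r=p \bmod s$ (so $0\le r<s$ and $p=ts+r$). With scalar coefficients $c_{s+1},\dots,c_{2s}$, $d_1,\dots,d_s$, $e_0,e_2,\dots,e_s$, $f_0,\dots,f_s$ and $a_0,\dots,a_{p-1}$, define $$y_{0s}(A)=A^s\sum_{i=1}^{s}c_{s+i}A^i,$$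 $$y_{1s}(A)=\Big(y_{0s}(A)+\sum_{i=1}^{s}d_iA^i\Big)\Big(y_{0s}(A)+\sum_{i=2}^{s}e_iA^i\Big)+e_0\,y_{0s}(A)+\sum_{i=0}^{s}f_iA^i,$$ where the powers $A^2,\dots,A^s$ are computed once and stored. Set $Z_0=y_{1s}(A)$ and, for $k=1,\dots,t$, $$Z_k=Z_{k-1}A^s+\sum_{i=1}^{s}a_{p-(k-1)s-i}A^{s-i},$$ and finally $$z_{1ps}(A)=Z_tA^{r}+\sum_{j=0}^{r-1}a_jA^j,$$ where for $r=0$ this means $z_{1ps}(A)=Z_t$ (no multiplication is performed). Evaluating $P_m(A)$ using this scheme means choosing the scalar coefficients so that $z_{1ps}(A)=P_m(A)$; if the leading coefficient of $P_m$ is negative, the scheme is instead equated to $-P_m(A)$ (to avoid complex coefficients), the sign change not being counted in the cost.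
   Formalization: Coefficients are real; evaluability of P_m is proved only if, once degrees 2s+1 to 4s of y_1s match the top part of ±P_m, degrees s+1 to 2s can be matched too; unconditionally it is false: x^8+x^3 with s=2 has no such coefficients. *)

(* Defs.v *)
From HB Require Import structures.
From mathcomp Require Import all_boot all_order all_algebra.

Set Implicit Arguments.
Unset Strict Implicit.
Unset Printing Implicit Defensive.

Import Order.TTheory GRing.Theory Num.Theory.
Local Open Scope ring_scope.

Definition ceil_div (a b : nat) : nat := ((a + b.-1) %/ b)%N.

(* Only c_(s+1), ..., c_(2s), d_1, ..., d_s, e_0, e_2, ..., e_s, f_0, ..., f_s
   and a_0, ..., a_(p-1) are ever read; in particular e_1 is not a parameter of
   the scheme. *)
Record coeffs (K : Type) := Coeffs {
  cc : nat -> K; cd : nat -> K; ce : nat -> K; cf : nat -> K; ca : nat -> K }.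

Definition map_coeffs (K L : Type) (h : K -> L) (co : coeffs K) : coeffs L :=
  Coeffs (h \o cc co) (h \o cd co) (h \o ce co) (h \o cf co) (h \o ca co).

(* The value of the scheme, in an arbitrary algebra B: B is instantiated both by
   square matrices and by polynomials (with X := 'X). *)
Section Scheme.
Variables (K : comNzRingType) (B : algType K) (s : nat) (co : coeffs K) (X : B).

Definition y0s : B := X ^+ s * \sum_(1 <= i < s.+1) cc co (s + i) *: X ^+ i.

Definition y1s : B :=
  (y0s + \sum_(1 <= i < s.+1) cd co i *: X ^+ i)
    * (y0s + \sum_(2 <= i < s.+1) ce co i *: X ^+ i)
  + ce co 0 *: y0s + \sum_(0 <= i < s.+1) cf co i *: X ^+ i.

Variable p : nat.

Fixpoint Zs (k : nat) : B :=
  if k is k'.+1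
  then Zs k' * X ^+ s
       + \sum_(1 <= i < s.+1) ca co (p - k' * s - i) *: X ^+ (s - i)
  else y1s.

Definition z1ps : B :=
  if (p %% s == 0)%N then Zs (p %/ s)
  else Zs (p %/ s) * X ^+ (p %% s) + \sum_(0 <= j < p %% s) ca co j *: X ^+ j.

End Scheme.

(* Computations that count products: a number of products together with a
   result. The cost is incremented by [mmul] only; sums, scalings and reuse of
   an already computed value are free. *)
Definition counted (T : Type) : Type := (nat * T)%type.
Definition ret (T : Type) (x : T) : counted T := (0%N, x).
Definition bind (T U : Type) (u : counted T) (k : T -> counted U) : counted U :=
  let v := k u.2 in ((u.1 + v.1)%N, v.2).
Definition mmul (B : pzRingType) (x y : B) : counted B := (1%N, x * y).

Notation "x <-- u ;; v" := (bind u (fun x => v))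
  (at level 61, u at next level, right associativity).

Section CountedScheme.
Variables (K : comNzRingType) (B : algType K) (s p : nat) (co : coeffs K) (X : B).

(* The stored powers [:: 1; X; X^2; ...; X^(k+1)]. *)
Fixpoint power_table (k : nat) : counted (seq B) :=
  if k is k'.+1
  then tab <-- power_table k' ;; y <-- mmul (last 1 tab) X ;; ret (rcons tab y)
  else ret [:: 1; X].

Section WithPowers.
Variable pw : seq B.

Definition eval_y1s : counted B :=
  y0 <-- mmul pw`_s (\sum_(1 <= i < s.+1) cc co (s + i) *: pw`_i) ;;
  w <-- mmul (y0 + \sum_(1 <= i < s.+1) cd co i *: pw`_i)
             (y0 + \sum_(2 <= i < s.+1) ce co i *: pw`_i) ;;
  ret (w + ce co 0 *: y0 + \sum_(0 <= i < s.+1) cf co i *: pw`_i).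

Fixpoint eval_Zs (k : nat) : counted B :=
  if k is k'.+1
  then z <-- eval_Zs k' ;; w <-- mmul z pw`_s ;;
       ret (w + \sum_(1 <= i < s.+1) ca co (p - k' * s - i) *: pw`_(s - i))
  else eval_y1s.

End WithPowers.

Definition eval_z1ps : counted B :=
  pw <-- power_table s.-1 ;;
  z <-- eval_Zs pw (p %/ s) ;;
  if (p %% s == 0)%N then ret z
  else w <-- mmul z pw`_(p %% s) ;;
       ret (w + \sum_(0 <= j < p %% s) ca co j *: pw`_j).

End CountedScheme.

Definition C_z1ps (s p : nat) : nat := (s + 1 + ceil_div p s)%N.

(* For m >= 1 and sigma >= 1 the truncated subtraction is exact. *)
Definition PS_cost (m sigma : nat) : nat := (sigma + ceil_div m sigma - 2)%N.

Definition is_C_PS (m c : nat) : Prop :=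
  (exists2 sigma, (1 <= sigma)%N & c = PS_cost m sigma) /\
  (forall sigma, (1 <= sigma)%N -> (c <= PS_cost m sigma)%N).

(* The scheme is equated to - P rather than P when the leading coefficient of P
   is negative. *)
Definition unsigned (R : numDomainType) (P : {poly R}) : {poly R} :=
  if lead_coef P < 0 then - P else P.

Definition y1s_matches (R : comNzRingType) (s : nat) (Q : {poly R})
    (lo hi : nat) (co : coeffs R) : Prop :=
  forall i, (lo < i <= hi)%N -> (y1s s co 'X)`_i = Q`_i.

(* Matching y_1s with a polynomial Q of degree 4s determines the c's and the
   sums d_i + e_i (with e_1 = 0) triangularly from the degrees 2s+1, ..., 4s,
   and the f's from the degrees 0, ..., s. The degrees s+1, ..., 2s leave a
   nonlinear system for e_0, e_2, ..., e_s, which is required here to have a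
   solution. This cannot be dispensed with: for s = 2 and Q = 'X^8 + 'X^3 there
   is none, even with complex coefficients, since the degrees 7, 6, 5 force
   c_3 = 0, e_2 = - d_2, d_1 = 0, so that the coefficient of 'X^3 in y_12, which
   is d_1 e_2 + e_0 c_3, vanishes. *)
Definition residual_solvable (R : comNzRingType) (s : nat) (Q : {poly R}) : Prop :=
  forall co, y1s_matches s Q (2 * s) (4 * s) co ->
  exists co', y1s_matches s Q s (4 * s) co'.

(* Main.v *)
(* The counted evaluation is the scheme itself, and the scheme commutes with
   X |-> A, so it suffices to match P with z_1ps at the polynomial 'X. There the
   scheme is Horner's rule in X^s, which reduces the matter to y_1s and the
   quotient of P by X^p.

   The cost equals s + ceil(m/s) - 3, one less than the Paterson-Stockmeyer cost
   with sigma = s, so any optimal sigma with 4 sigma <= m will do. From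
   (sigma + ceil(m/sigma))^2 >= 4m the floor of sqrt(m) is always optimal, and it
   satisfies the constraint except for m = 9, 10, 11; for m = 10, sigma = 2 is
   also optimal. *)
Require Import Defs.
From HB Require Import structures.
From mathcomp Require Import all_boot all_order all_algebra.
From mathcomp Require Import zify ring.

Set Implicit Arguments.
Unset Strict Implicit.
Unset Printing Implicit Defensive.

Import Order.TTheory GRing.Theory Num.Theory.
Local Open Scope ring_scope.

(** * Cost and value of the counted evaluation *)

Section CountedEvaluation.
Variables (K : comNzRingType) (B : algType K) (X : B).

Lemma power_tableE k :
  power_table X k = (k, [seq X ^+ i | i <- iota 0 k.+2]).
Proof.
elim: k => [|k IHk]; first by rewrite /= expr0 expr1.
have mapSr i : [seq X ^+ j | j <- iota 0 i.+1]
             = rcons [seq X ^+ j | j <- iota 0 i] (X ^+ i).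
  by rewrite -map_rcons -cats1 -addn1 iotaD.
rewrite [power_table _ _]/= IHk /bind /ret /mmul addn0 addn1.
by congr (_, _); rewrite [RHS]mapSr exprSr mapSr last_rcons.
Qed.

Variables (s p : nat) (co : coeffs K).
Hypothesis s_gt0 : (0 < s)%N.

Let pw : seq B := [seq X ^+ i | i <- iota 0 s.+1].

Let nth_pw i : (i <= s)%N -> pw`_i = X ^+ i.
Proof. by move=> le_is; rewrite (nth_map 0%N) ?size_iota // nth_iota. Qed.

Lemma eval_y1sE : eval_y1s s co pw = (2%N, y1s s co X).
Proof.
have sum_pw a (g : nat -> K) :
    \sum_(a <= i < s.+1) g i *: pw`_i = \sum_(a <= i < s.+1) g i *: X ^+ i.
  by apply: eq_big_nat => i /andP[_ lt_is]; rewrite nth_pw.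
by rewrite /eval_y1s /bind /= !sum_pw nth_pw.
Qed.

Lemma eval_ZsE k : eval_Zs s p co pw k = (k.+2, Zs s co X p k).
Proof.
elim: k => [|k IHk] /=; first exact: eval_y1sE.
rewrite IHk /bind /= nth_pw // addn1; congr (_, _ + _).
by apply: eq_big_nat => i _; rewrite nth_pw ?leq_subr.
Qed.

(** This is the count as the scheme produces it: [p %/ s] Horner steps, and one more product exactly
    when the remainder is nonzero. *)
Lemma ceil_divE : ceil_div p s = (p %/ s + (p %% s != 0))%N.
Proof.
rewrite /ceil_div {1}(divn_eq p s) -addnA divnMDl //; congr (_ + _)%N.
have := ltn_pmod p s_gt0; case: (p %% s)%N => [|r] lt_rs /=.
  by rewrite divn_small //; case: s s_gt0.
have -> : (r.+1 + s.-1 = r + 1 * s)%N by case: s s_gt0 lt_rs => //= ? _ _; lia.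
by rewrite divnDMl // divn_small // ltnW.
Qed.

Lemma eval_z1psE : eval_z1ps s p co X = (C_z1ps s p, z1ps s co X p).
Proof.
have tabE : power_table X s.-1 = (s.-1, pw) by rewrite power_tableE prednK.
rewrite /eval_z1ps /z1ps tabE /bind /= eval_ZsE /C_z1ps ceil_divE /=.
have le_rs := ltnW (ltn_pmod p s_gt0).
case: eqP => [_|_] /=; congr (_, _); [lia|lia|].
rewrite nth_pw //; congr (_ + _).
apply: eq_big_nat => i /andP[_ lt_ir].
by rewrite nth_pw // ltnW ?(leq_trans lt_ir).
Qed.

End CountedEvaluation.

(** * Transport of the scheme along ring morphisms *)

Section SchemeMorphism.
Variables (K L : comNzRingType) (h : K -> L) (B : algType K) (B' : algType L).
Variables (f : {rmorphism B -> B'}).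
Hypothesis fZ : forall a x, f (a *: x) = h a *: f x.
Variables (s p : nat) (co : coeffs K) (X : B).

(** Scalars may change along [h], so that one [f] can both extend the coefficients and evaluate at a
    matrix. *)
Lemma rmorph_z1ps : f (z1ps s co X p) = z1ps s (map_coeffs h co) (f X) p.
Proof.
have f_sum a b (g : nat -> K) (e : nat -> nat) :
    f (\sum_(a <= i < b) g i *: X ^+ e i)
    = \sum_(a <= i < b) h (g i) *: f X ^+ e i.
  by rewrite rmorph_sum; apply: eq_bigr => i _; rewrite fZ rmorphXn.
have f_y0s : f (y0s s co X) = y0s s (map_coeffs h co) (f X).
  by rewrite /y0s rmorphM rmorphXn f_sum.
have f_Zs k : f (Zs s co X p k) = Zs s (map_coeffs h co) (f X) p k.
  elim: k => [|k IHk] /=.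
    by rewrite /y1s !rmorphD [f (_ * _)]rmorphM !rmorphD /= fZ f_y0s !f_sum.
  by rewrite rmorphD rmorphM rmorphXn IHk f_sum.
rewrite /z1ps; case: ifP => _ //.
by rewrite rmorphD rmorphM rmorphXn f_Zs f_sum.
Qed.

End SchemeMorphism.

(** * Horner's rule in ['X^s] *)

Lemma coef_sum_scaleXn (R : nzRingType) (a b : nat) (g : nat -> R) (k : nat) :
  (\sum_(a <= i < b) g i *: 'X^i)`_k = if (a <= k < b)%N then g k else 0.
Proof.
rewrite coef_sum; under eq_bigr do rewrite coefZ coefXn.
case: ifP => [kab|/negP kab].
  rewrite (big_cat_nat (n := k)) /=; [|lia|lia].
  rewrite [X in _ + X]big_ltn /=; last lia.
  rewrite eqxx mulr1 !big_nat !big1 ?addr0 ?add0r // => i /andP[? ?];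
  by rewrite (_ : (k == i) = false) ?mulr0 //; lia.
rewrite big_nat big1 // => i iab; case: eqP => [ki|]; last by rewrite mulr0.
by rewrite ki in kab.
Qed.

Section MatchHorner.
Variables (R : comNzRingType) (s p : nat) (co : coeffs R) (P : {poly R}).
Hypothesis s_gt0 : (0 < s)%N.
Hypothesis y1sE : y1s s co 'X = drop_poly p P.
Hypothesis caE : forall j, (j < p)%N -> ca co j = P`_j.

Lemma Zs_drop_poly k : (k * s <= p)%N ->
  Zs s co 'X p k = drop_poly (p - k * s) P.
Proof.
elim: k => [|k IHk] le_ksp; first by rewrite /= y1sE subn0.
rewrite /= IHk; last by lia.
apply/polyP => j; rewrite coefD coefMXn !coef_drop_poly.
(* Reversal makes the exponents ascend: the term [i] becomes the one of degree [i.-1], with its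
   coefficient index offset by [p - k.+1 * s]. *)
rewrite big_nat_rev /=.
rewrite (eq_big_nat _ _
  (F2 := fun i => ca co (p - k.+1 * s + i.-1) *: 'X^(i.-1))); last first.
  move=> i /andP[i1 i2]; congr (ca co _ *: 'X^_); lia.
rewrite big_add1 /= coef_sum_scaleXn /=.
case: ltnP => lt_js; last by rewrite addr0; congr (P`_ _); lia.
by rewrite add0r caE; [congr (P`_ _)|]; lia.
Qed.

Lemma z1ps_polyX : z1ps s co 'X p = P.
Proof.
have le_tsp : (p %/ s * s <= p)%N := leq_divM p s.
have pr : (p - p %/ s * s = p %% s)%N by rewrite {1}(divn_eq p s) addKn.
rewrite /z1ps Zs_drop_poly // pr; case: eqP => [->|_].
  by rewrite drop_poly0l.
apply/polyP => j; rewrite coefD coefMXn coef_drop_poly coef_sum_scaleXn /=.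
case: ltnP => lt_jr; last by rewrite addr0 subnK.
by rewrite add0r caE // (leq_trans lt_jr) // leq_mod.
Qed.

End MatchHorner.

(** * Solving for the coefficients of [y1s] *)

Section SquareRootTop.
Variables (R : rcfType) (n : nat) (Q : {poly R}).
Hypothesis Q_gt0 : 0 < Q`_(2 * n).

Lemma sqrt_poly_top k : (k <= n)%N ->
  exists Y : {poly R},
    [/\ (size Y <= n.+1)%N, Y`_n != 0,
        forall i, (i + k < n)%N -> Y`_i = 0
      & forall i, (2 * n - k <= i <= 2 * n)%N -> (Y ^+ 2)`_i = Q`_i].
Proof.
elim: k => [|k IHk] le_kn.
  exists (Num.sqrt Q`_(2 * n) *: 'X^n); split.
  - by apply/leq_sizeP => i lt_ni; rewrite coefZ coefXn gtn_eqF // mulr0.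
  - by rewrite coefZ coefXn eqxx mulr1 sqrtr_eq0 -ltNge.
  - by move=> i lt_in; rewrite coefZ coefXn ltn_eqF ?mulr0 //; lia.
  - move=> i i2n; have -> : i = (2 * n)%N by lia.
    by rewrite exprZn coefZ sqr_sqrtr ?ltW // -exprM coefXn mulnC eqxx mulr1.
have [Y [szY Yn0 Ylow YQ]] := IHk (ltnW le_kn).
set e := (n - k.+1)%N; set j := (2 * n - k.+1)%N.
pose a := (Q`_j - (Y ^+ 2)`_j) / (2 * Y`_n).
have sqrE i : ((Y + a *: 'X^e) ^+ 2)`_i
    = (Y ^+ 2)`_i + 2 * a * (if (i < e)%N then 0 else Y`_(i - e))
      + a ^+ 2 * (i == (e * 2)%N)%:R.
  have -> : (Y + a *: 'X^e) ^+ 2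
          = Y ^+ 2 + (2 * a) *: (Y * 'X^e) + a ^+ 2 *: 'X^(e * 2).
    by rewrite -!mul_polyC !rmorphM /= exprM rmorph_nat; ring.
  by rewrite !coefD !coefZ coefMXn coefXn.
exists (Y + a *: 'X^e); split.
- apply/leq_sizeP => i lt_ni; rewrite coefD coefZ coefXn (leq_sizeP _ _ szY) //.
  by rewrite gtn_eqF ?mulr0 ?addr0 //; lia.
- by rewrite coefD coefZ coefXn gtn_eqF ?mulr0 ?addr0 //; lia.
- move=> i lt_in; rewrite coefD coefZ coefXn Ylow; last lia.
  by rewrite ltn_eqF ?mulr0 ?addr0 //; lia.
(* The quadratic term sits in degree [2 * e], strictly below [j = n + e]. *)
move=> i i2n; rewrite sqrE (_ : (i == _) = false); last lia.
rewrite mulr0 addr0 ltnNge (_ : (e <= i)%N) /=; last lia.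
have [ij|ij] := eqVneq i j.
  rewrite ij (_ : (j - e)%N = n); last lia.
  by rewrite /a; field.
rewrite YQ; last lia.
by rewrite (leq_sizeP _ _ szY) ?mulr0 ?addr0 //; lia.
Qed.

End SquareRootTop.

(* With e = f = 0 and Y the polynomial y_0s, the top degrees of Q fix Y through
   Y^2, and the next ones fix D as the quotient of Q - Y^2 by Y. Discarding the
   constant term of D only alters degrees at most 2s. *)
Lemma y1s_matches_top (R : rcfType) (s : nat) (Q : {poly R}) :
  (0 < s)%N -> (size Q <= (4 * s).+1)%N -> 0 < Q`_(4 * s) ->
  exists co, y1s_matches s Q (2 * s) (4 * s) co.
Proof.
move=> s_gt0 szQ Q_gt0.
(* Stopping at [s.-1] leaves [Y] only degrees [s+1] to [2s], the shape of [y0s]. The square then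
   agrees with [Q] from degree [3s+1] on, so the quotient [D] has degree at most [s]. *)
have [||Y [szY Y0 Ylow YQ]] := @sqrt_poly_top R (2 * s) Q _ s.-1.
- by rewrite mulnA.
- lia.
have sizeY : size Y = (2 * s).+1.
  by apply/eqP; rewrite eqn_leq szY ltnNge; apply: contraNN Y0 => /leq_sizeP->.
pose D := (Q - Y ^+ 2) %/ Y.
have szQY : (size (Q - Y ^+ 2)%R <= (3 * s).+1)%N.
  apply/leq_sizeP => i lt_i; rewrite coefB.
  have [le_i|gt_i] := leqP i (4 * s); first by rewrite YQ ?subrr //; lia.
  rewrite (leq_sizeP _ _ szQ) // nth_default ?subrr //.
  by rewrite expr2 (leq_trans (size_polyMleq _ _)) // sizeY; lia.
have Yn0 : Y != 0 by rewrite -size_poly_eq0 sizeY.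
have szD : (size D <= s.+1)%N.
  by rewrite size_divp // sizeY leq_subLR; apply: leq_trans szQY _; lia.
exists (Coeffs (fun i => Y`_i) (fun i => D`_i) (fun=> 0) (fun=> 0) (fun=> 0)).
move=> i lt_i; rewrite /y1s /=.
have -> : y0s s (Coeffs (fun i => Y`_i) (fun i => D`_i) (fun=> 0) (fun=> 0)
                        (fun=> 0)) 'X = Y.
  apply/polyP => j; rewrite /y0s coefXnM coef_sum_scaleXn /=.
  case: ltnP => [lt_js|le_sj]; first by rewrite Ylow //; lia.
  rewrite subnKC //; case: ifP => // /negbT nj.
  have [|] := leqP j s => ?; first by rewrite Ylow //; lia.
  by rewrite (leq_sizeP _ _ szY) //; lia.
have -> : \sum_(1 <= i < s.+1) D`_i *: 'X^i = D - (D`_0)%:P.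
  apply/polyP => j; rewrite coef_sum_scaleXn coefB coefC.
  case: j => [|j] /=; first by rewrite subrr.
  rewrite subr0; case: ltnP => // le_sj.
  by rewrite (leq_sizeP _ _ szD).
rewrite !big1 ?scale0r ?addr0; try by move=> *; rewrite scale0r.
(* Both error terms, the remainder and the multiple of [Y], have degree at most [2s]. *)
have -> : (Y + (D - (D`_0)%:P)) * Y
          = Q - (Q - Y ^+ 2) %% Y - D`_0 *: Y.
  have := divp_eq (Q - Y ^+ 2) Y; rewrite -/D => E.
  have -> : (Q - Y ^+ 2) %% Y = Q - Y ^+ 2 - D * Y.
    by apply: (addrI (D * Y)); rewrite -E; ring.
  by rewrite -mul_polyC; ring.
rewrite !coefB coefZ (leq_sizeP _ _ szY); last lia.
rewrite mulr0 subr0 [X in _ - X]nth_default ?subr0 //.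
have : (size ((Q - Y ^+ 2) %% Y)%R < size Y)%N by rewrite ltn_modp.
by rewrite sizeY ltnS => /leq_trans; apply; lia.
Qed.

Lemma size_y1s (R : comNzRingType) (s : nat) (co : coeffs R) :
  (size (y1s s co 'X) <= (4 * s).+1)%N.
Proof.
have sz_sum a (g : nat -> R) :
    (size (\sum_(a <= i < s.+1) g i *: 'X^i)%R <= s.+1)%N.
  apply/leq_sizeP => i lt_si; rewrite coef_sum_scaleXn.
  by case: ifP => // ?; lia.
have sz_y0 : (size (y0s s co 'X) <= (2 * s).+1)%N.
  rewrite /y0s (leq_trans (size_polyMleq _ _)) // size_polyXn.
  have := sz_sum 1%N (fun i => cc co (s + i)).
  by case: (size _) => [|k]; lia.
have szD (u v : {poly R}) k : (size u <= k)%N -> (size v <= k)%N ->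
    (size (u + v)%R <= k)%N.
  by move=> ? ?; rewrite (leq_trans (size_polyD _ _)) // geq_max; apply/andP.
have sz_y0D a (g : nat -> R) :
    (size (y0s s co 'X + \sum_(a <= i < s.+1) g i *: 'X^i)%R <= (2 * s).+1)%N.
  by apply: szD => //; rewrite (leq_trans (sz_sum _ _)) //; lia.
rewrite /y1s; apply: (szD); last by rewrite (leq_trans (sz_sum _ _)) //; lia.
apply: szD; last by rewrite (leq_trans (size_scale_leq _ _)) //; lia.
rewrite (leq_trans (size_polyMleq _ _)) //.
have := leq_add (sz_y0D 1%N (cd co)) (sz_y0D 2%N (ce co)).
by case: (_ + _)%N => [|k]; lia.
Qed.

(** The [f]'s enter [y1s] additively in degrees 0 to [s], so they absorb whatever difference remains
    there; the [a]'s do not enter it and can be prescribed. *)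
Lemma y1s_complete (R : comNzRingType) (s : nat) (Q : {poly R})
    (co : coeffs R) (a : nat -> R) :
  (size Q <= (4 * s).+1)%N -> y1s_matches s Q s (4 * s) co ->
  exists2 co' : coeffs R, y1s s co' 'X = Q & ca co' = a.
Proof.
move=> szQ coQ; pose g i := (Q - y1s s co 'X)`_i.
exists (Coeffs (cc co) (cd co) (ce co) (fun i => cf co i + g i) a) => //.
transitivity (y1s s co 'X + \sum_(0 <= i < s.+1) g i *: 'X^i).
  rewrite /y1s /y0s /= -[RHS]addrA; congr (_ + _).
  by rewrite -big_split; apply: eq_bigr => i _; rewrite scalerDl.
apply/polyP => i; rewrite coefD coef_sum_scaleXn /g /= coefB.
case: ltnP => [_|lt_si]; first by rewrite addrC subrK.
rewrite addr0; have [le_i|lt_i] := leqP i (4 * s); first by rewrite coQ ?lt_si.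
by rewrite (leq_sizeP _ _ szQ) // (leq_sizeP _ _ (size_y1s s co)).
Qed.

(** * Sign normalisation and the full match *)

Lemma unsigned_gt0 (R : realDomainType) (P : {poly R}) :
  P != 0 -> 0 < lead_coef (unsigned P).
Proof.
rewrite -lead_coef_eq0 /unsigned => P0; case: ifP => [lt0|/negbT ge0].
  by rewrite lead_coefN oppr_gt0.
by rewrite lt_neqAle eq_sym P0 leNgt.
Qed.

Lemma size_unsigned (R : numDomainType) (P : {poly R}) :
  size (unsigned P) = size P.
Proof. by rewrite /unsigned; case: ifP; rewrite ?size_polyN. Qed.

(** The quotient by ['X^p] is matched in three ranges: above [2s] by square root and division, from
    [s+1] to [2s] by the solvability hypothesis, and up to [s] by the [f]'s. The [a]'s supply the
    low coefficients of the polynomial itself. *)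
Lemma z1ps_matches (R : rcfType) (s p : nat) (P : {poly R}) :
  (0 < s)%N -> size P = (4 * s + p).+1 ->
  residual_solvable s (drop_poly p (unsigned P)) ->
  exists co : coeffs R, z1ps s co 'X p = unsigned P.
Proof.
move=> s_gt0 szP solv; set Q := drop_poly p (unsigned P) in solv.
have szQ : size Q = (4 * s).+1 by rewrite size_drop_poly size_unsigned szP; lia.
have Q_gt0 : 0 < Q`_(4 * s).
  have := @unsigned_gt0 R P; rewrite -size_poly_eq0 szP => /(_ isT).
  by rewrite coef_drop_poly lead_coefE size_unsigned szP.
have [|co1 /solv [co2 co2Q]] := y1s_matches_top s_gt0 _ Q_gt0.
  by rewrite szQ.
have [|co y1sQ coa] := y1s_complete (fun j => (unsigned P)`_j) _ co2Q.
  by rewrite szQ.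
by exists co; apply: z1ps_polyX => // j _; rewrite coa.
Qed.

(** * Optimal Paterson-Stockmeyer costs *)

Lemma ceil_div_leq (m b q : nat) : (0 < b)%N ->
  (ceil_div m b <= q)%N = (m <= b * q)%N.
Proof.
move=> b_gt0; rewrite -ltnS /ceil_div ltn_divLR // mulSn mulnC.
by case: b b_gt0 => //= b _; lia.
Qed.

Lemma PS_cost_lower_bound (m sigma : nat) : (1 <= sigma)%N ->
  (4 * m <= (PS_cost m sigma).+2 ^ 2)%N.
Proof.
move=> sigma_gt0; have := ceil_div_leq m (ceil_div m sigma) sigma_gt0.
rewrite leqnn /PS_cost => /esym m_le.
(* Truncation of the subtraction can only increase the right-hand side. *)
have : (sigma + ceil_div m sigma <= (sigma + ceil_div m sigma - 2).+2)%N by lia.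
rewrite -leq_sqr => /(leq_trans _); apply.
by apply: leq_trans (nat_AGM2 _ _); rewrite leq_mul2l.
Qed.

Lemma PS_cost_floor_sqrt (m n sigma : nat) :
  (1 <= n)%N -> (n ^ 2 <= m < n.+1 ^ 2)%N -> (1 <= sigma)%N ->
  (PS_cost m n <= PS_cost m sigma)%N.
Proof.
rewrite -!mulnn => n_gt0 /andP[le_nm lt_mn] /(PS_cost_lower_bound m).
rewrite -mulnn; move: (PS_cost m sigma) => c lb.
have c_ge : (2 * n <= c.+2)%N by nia.
have := ceil_div_leq m (c.+2 - n) n_gt0; rewrite /PS_cost.
suff -> : (m <= n * (c.+2 - n))%N by lia.
(* The goal becomes [m <= n * (n + d)]. For [d] equal to 0 or 1 it follows from [lb] by integrality;
   for [d >= 2], from [m <= n ^ 2 + 2 * n]. *)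
have [d cE] : exists d, c.+2 = (2 * n + d)%N by exists (c.+2 - 2 * n)%N; lia.
rewrite {}cE in lb c_ge *; have -> : (2 * n + d - n = n + d)%N by lia.
by case: d lb {c_ge} => [|[|d]]; nia.
Qed.

Lemma C_z1psE (s m : nat) : (0 < s)%N -> (4 * s <= m)%N ->
  C_z1ps s (m - 4 * s) = (PS_cost m s - 1)%N.
Proof.
move=> s_gt0 le_4sm; rewrite /C_z1ps /PS_cost /ceil_div.
have -> : (m + s.-1 = 4 * s + (m - 4 * s + s.-1))%N by lia.
by rewrite divnMDl //; move: (_ %/ s)%N => q; lia.
Qed.

Theorem theorem3p1 (R : rcfType) :
  (forall m s p : nat, (8 <= m)%N -> (2 <= s)%N -> m = (4 * s + p)%N ->
     (forall (K : fieldType) (co : coeffs K) (n : nat) (A : 'M[K]_n.+1),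
        eval_z1ps s p co A = (C_z1ps s p, z1ps s co A p)) /\
     (forall P : {poly R}, size P = m.+1 ->
        residual_solvable s (drop_poly p (unsigned P)) ->
        exists co : coeffs R,
          forall (K : fieldType) (iota : {rmorphism R -> K}) (n : nat)
                 (A : 'M[K]_n.+1),
            eval_z1ps s p (map_coeffs iota co) A
            = (C_z1ps s p, horner_mx A (map_poly iota (unsigned P))))) /\
  (forall m : nat, (8 <= m)%N -> m <> 9%N -> m <> 11%N ->
     exists s c : nat,
       [/\ (2 <= s)%N, (4 * s <= m)%N, is_C_PS m c
         & C_z1ps s (m - 4 * s) = (c - 1)%N]).
Proof.
split=> [m s p _ s_ge2 -> | m m_ge8 m9 m11].
  have s_gt0 : (0 < s)%N := ltnW s_ge2.
  split=> [K co n A | P szP solv]; first exact: eval_z1psE.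
  have [co coP] := z1ps_matches s_gt0 szP solv; exists co => K iota n A.
  rewrite eval_z1psE //; congr (_, _).
  (* Coefficient extension followed by evaluation at [A], semilinear along [iota]. *)
  pose f : {rmorphism {poly R} -> 'M[K]_n.+1} := horner_mx A \o map_poly iota.
  have fZ a x : f (a *: x) = iota a *: f x.
    by rewrite /f /= map_polyZ linearZ.
  rewrite -coP -[RHS]/(f _) (rmorph_z1ps fZ).
  by congr (z1ps _ _ _ _); rewrite /f /= map_polyX horner_mx_X.
have optimal s : (2 <= s)%N -> (4 * s <= m)%N ->
    (forall sigma, (1 <= sigma)%N -> (PS_cost m s <= PS_cost m sigma)%N) ->
    exists s c : nat, [/\ (2 <= s)%N, (4 * s <= m)%N, is_C_PS m c
                         & C_z1ps s (m - 4 * s) = (c - 1)%N].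
  move=> s_ge2 le_4sm s_opt; exists s, (PS_cost m s).
  by split=> //; [split=> //; exists s => //; apply: ltnW|apply: C_z1psE; lia].
(* Here the integer square root 3 violates [4 * s <= m]. The choice 2 costs 5, and a cost of at most
   4 would give [40 <= 36]. *)
have [m10|m10] := eqVneq m 10.
  apply: (optimal 2%N) => // sigma.
  move/(PS_cost_lower_bound m); rewrite m10.
  by case: (PS_cost 10 sigma) => [|[|[|[|[|c]]]]].
have sqr0 : exists n, (n ^ 2 <= m)%N by exists 0%N.
have sqr_bound n : (n ^ 2 <= m)%N -> (n <= m)%N by nia.
case: (ex_maxnP sqr0 sqr_bound) => n le_nm n_max.
have lt_mn : (m < n.+1 ^ 2)%N.
  by rewrite ltnNge; apply/negP => /n_max; rewrite ltnn.
have n_ge2 : (2 <= n)%N by nia.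
apply: (optimal n) => // [|sigma]; last first.
  by apply: PS_cost_floor_sqrt; [exact: ltnW | rewrite le_nm].
(* From 4 on, [4 * n <= n ^ 2]. For [n = 2] only [m = 8] remains, and for [n = 3] the excluded
   values leave [m >= 12]. *)
have [n_ge4|] := leqP 4 n; first by nia.
by case: n n_ge2 le_nm lt_mn {n_max} => [|[|[|[|n]]]] //; lia.
Qed.
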